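(* Let $G$ be a finite group of order $n=|G|$ with an irreducible unitary representation on a $d$-dimensional Hilbert space $\mathcal{H}$ (the representing unitary of $g\in G$ is also denoted $g$). Let $\rho$ be a quantum state on $\mathcal{H}$ (the generator) and consider the geometrically uniform ensemble $(\frac1n,\rho_g)_{g\in G}$ with $\rho_g=g\rho g^\dagger$. For $\alpha\ge 1$ let $p_{\mathrm{succ}}(\alpha)=\frac1n\sum_{g\in G}\operatorname{tr}(\rho_gM_g^{(\alpha)})$ be the success probability of the $\alpha$-power-PGM $(M_g^{(\alpha)})_{g\in G}$ of this ensemble, and let $p_{\mathrm{succ}}^*$ be the optimal success probability of discriminating the ensemble, which equals $\frac{d}{n}\lambda_{\max}(\rho)$. Then $$p_{\mathrm{succ}}(\alpha)=\frac{d}{n}\,\frac{\operatorname{tr}(\rho^{\alpha+1})}{\operatorname{tr}(\rho^{\alpha})}.$$ If the generator $\rho$ is pure, then $\operatorname{tr}(\rho^{\alpha+1})=\operatorname{tr}(\rho^\alpha)$ and the pretty good measurement (the case $\alpha=1$) is optimal. If the generator $\rho$ is mixed, then the maximum $p_{\mathrm{succ}}^*=\frac{d}{n}\lambda_{\max}(\rho)$ is reached only in the limit $\alpha\to\infty$, that is, $\lim_{\alpha\to\infty}p_{\mathrm{succ}}(\alpha)=p_{\mathrm{succ}}^*$ and $p_{\mathrm{succ}}(\alpha)<p_{\mathrm{succ}}^*$ for all finite $\alpha$. Thus, for mixed generators the $\alpha$-power-PGMs with finite $\alpha<\infty$ are strictly suboptimal.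
   Context: A quantum state is a positive semidefinite operator of unit trace; it is pure if it has rank one and mixed otherwise. $\lambda_{\max}(\rho)$ is the largest eigenvalue of $\rho$. For an ensemble $(p_i,\rho_i)_i$ and $\alpha\ge 1$, the $\alpha$-power-PGM (power pretty good measurement) is $M_i^{(\alpha)}=\tilde\rho^{-1/2}(p_i\rho_i)^\alpha\tilde\rho^{-1/2}$ with $\tilde\rho=\sum_i(p_i\rho_i)^\alpha$, the inverse being taken on the support of $\tilde\rho$; for $\alpha=1$ it is the pretty good measurement (PGM). Here it is applied with index set $G$ and $p_g=\frac1n$. A POVM is a family $(M_g)_{g\in G}$ of positive semidefinite operators with $\sum_gM_g=\mathbb{I}$, and $p_{\mathrm{succ}}^*=\max\{\frac1n\sum_{g\in G}\operatorname{tr}(M_g\rho_g):(M_g)_{g\in G}\text{ a POVM}\}$; a measurement is optimal if it attains this maximum.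
   Formalization: For mixed generators, strict inequality and strict suboptimality at finite α are stated only when the nonzero eigenvalues of ρ are not all equal; otherwise (e.g. ρ = I/d, d ≥ 2) p_succ(α) = p*_succ for every α, so the claim as stated fails. *)

(* Defs.v *)
From HB Require Import structures.
From mathcomp Require Import all_boot all_order all_algebra all_fingroup.
From mathcomp Require Import mxrepresentation complex.
From mathcomp Require Import boolp classical_sets reals topology normedtype exp.

Set Implicit Arguments.
Unset Strict Implicit.
Unset Printing Implicit Defensive.

Import Order.TTheory GRing.Theory Num.Theory.
Import numFieldNormedType.Exports.

Local Open Scope classical_set_scope.
Local Open Scope complex_scope.
Local Open Scope sesquilinear_scope.
Local Open Scope ring_scope.

Section Operators.
Variables (R : realType) (d : nat).
Implicit Types A rho : 'M[R[i]]_d.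

(* In R[i], [0 <= z] also says that z is real. *)
Definition psd A : Prop :=
  A \is hermsymmx /\ forall v : 'cV[R[i]]_d, 0 <= (v^t* *m A *m v) 0 0.

(* Real power of a positive semidefinite matrix by functional calculus: the
   diagonalization A = U^-1 diag(a_i) U, U unitary, is sent to
   U^-1 diag(a_i `^ s) U. Since 0 `^ s = 0 for every s <> 0, the inverse in
   [mxpow A (- 2^-1)] is taken on the support of A. Meaningless if A is not
   positive semidefinite. *)
Definition mxpow A (s : R) : 'M[R[i]]_d :=
  invmx (spectralmx A)
  *m diag_mx (map_mx (fun z => (complex.Re z `^ s)%:C) (spectral_diag A))
  *m spectralmx A.

Definition quantum_state rho : Prop := psd rho /\ \tr rho = 1.

Definition pure_state rho : Prop := quantum_state rho /\ \rank rho = 1%N.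

Definition mixed_state rho : Prop := quantum_state rho /\ \rank rho <> 1%N.

(* The eigenvalues of a Hermitian matrix are real and finite in number, so that
   this supremum is a maximum (for 0 < d). *)
Definition lambda_max A : R := sup [set x : R | eigenvalue A x%:C].

(* All the nonzero eigenvalues coincide: for a state, rho = P / \rank P with P
   an orthogonal projector. Every pure state is flat, and so is the (mixed, if
   1 < d) state d^-1 I. *)
Definition flat_spectrum A : Prop :=
  forall a b : R[i], eigenvalue A a -> eigenvalue A b ->
    a != 0 -> b != 0 -> a = b.

End Operators.

Section Discrimination.
Variables (R : realType) (d : nat) (I : finType).
Implicit Types (p : I -> R) (rhos M N : I -> 'M[R[i]]_d).

Definition povm M : Prop := (forall i, psd (M i)) /\ \sum_i M i = 1%:M.

(* The traces are real when the M i and the rhos i are Hermitian. *)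
Definition succ_prob p rhos M : R :=
  \sum_i p i * complex.Re (\tr (M i *m rhos i)).

Definition opt_succ_prob p rhos : R :=
  sup [set x | exists2 M, povm M & x = succ_prob p rhos M].

Definition optimal p rhos M : Prop :=
  povm M /\ forall N, povm N -> succ_prob p rhos N <= succ_prob p rhos M.

Definition power_pgm p rhos (alpha : R) : I -> 'M[R[i]]_d :=
  let E i := mxpow ((p i)%:C *: rhos i) alpha in
  let S := mxpow (\sum_i E i) (- 2^-1) in
  fun i => S *m E i *m S.

End Discrimination.

Section GeometricallyUniform.
Variables (R : realType) (gT : finGroupType) (d : nat).
Variable rG : mx_representation R[i] [set: gT]%G d.

(* Irreducibility of rG in the library is about row spaces stable under right
   multiplication. For a unitary rG, W |-> W^t* is a bijection from these to
   the column spaces stable under left multiplication. *)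
Definition unitary_rep : Prop := forall g : gT, rG g \is unitarymx.

Definition gu_state (rho : 'M[R[i]]_d) (g : gT) : 'M[R[i]]_d :=
  rG g *m rho *m (rG g)^t*.

End GeometricallyUniform.

(* Main.v *)
(** By Schur's lemma, averaging an operator over the group gives a scalar. If
    rho = U^* diag(a) U with U unitary and b >= 0 has sum d/n, the orbit of
    U^* diag(b) U is therefore a POVM, and it succeeds with probability
    sum_i b_i a_i. The alpha-power-PGM is the case b ~ a^alpha, because the
    operator to be inverted is scalar; the point mass at the largest a_i reaches
    (d/n) max a, and no POVM (N_g) can exceed it since
    tr (N_g rho_g) <= max a * tr N_g. What remains is that the mean
    (sum_i a_i^(s+1)) / (sum_i a_i^s) stays below max a, strictly as soon as
    some a_i lies strictly between 0 and max a, and approaches it at rate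
    O(1/s). *)

Require Import Defs.
From HB Require Import structures.
From mathcomp Require Import all_boot all_order all_algebra all_fingroup.
From mathcomp Require Import mxrepresentation complex.
From mathcomp Require Import boolp classical_sets reals topology normedtype exp.
From mathcomp Require Import sequences ring lra.

Set Implicit Arguments.
Unset Strict Implicit.
Unset Printing Implicit Defensive.

Import Order.TTheory GRing.Theory Num.Theory.
Import numFieldNormedType.Exports.

Local Open Scope classical_set_scope.
Local Open Scope complex_scope.
Local Open Scope ring_scope.

(** * Unitary diagonalizations and functional calculus *)

Section UnitaryDiagonal.
Variables (R : realType) (d : nat).
Local Open Scope sesquilinear_scope.
Implicit Types (A B U : 'M[R[i]]_d) (a b : 'I_d -> R).

Definition rdiag a : 'M[R[i]]_d := diag_mx (\row_i (a i)%:C).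

(** The rows of a unitary [U] are left eigenvectors. The spectrum is kept as a real-valued function,
    so that its sums and powers are computed in [R]. *)
Definition udiag U a : 'M[R[i]]_d := U^t* *m rdiag a *m U.

Lemma adjmx_mul m n p (A : 'M[R[i]]_(m, n)) (B : 'M[R[i]]_(n, p)) :
  (A *m B)^t* = B^t* *m A^t*.
Proof. by rewrite trmx_mul map_mxM. Qed.

Lemma hermsymmxP A : reflect (A = A^t*) (A \is hermsymmx).
Proof. by apply: (iffP (is_hermitianmxP _ _ _)); rewrite expr0 scale1r. Qed.

Lemma unitary_mulVmx U : U \is unitarymx -> U^t* *m U = 1%:M.
Proof.
by move=> Uu; rewrite -(invmx_unitary Uu) mulVmx // unitarymx_unit.
Qed.

Lemma rdiagE a i j : rdiag a i j = (a i)%:C *+ (i == j).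
Proof. by rewrite !mxE. Qed.

Lemma adj_rdiag a : (rdiag a)^t* = rdiag a.
Proof.
apply/matrixP => i j; rewrite !mxE eq_sym.
case: eqP => [->|_]; rewrite ?mulr1n ?mulr0n ?conjC0 //; exact: conjc_real.
Qed.

Lemma rdiagM a b : rdiag a *m rdiag b = rdiag (fun i => a i * b i).
Proof.
rewrite mulmx_diag; congr diag_mx; apply/rowP => i.
by rewrite !mxE rmorphM.
Qed.

Lemma udiagM U a b : U \is unitarymx ->
  udiag U a *m udiag U b = udiag U (fun i => a i * b i).
Proof.
move=> /unitarymxP UU; rewrite /udiag -rdiagM !mulmxA.
by rewrite -(mulmxA (U^t* *m rdiag a) U) UU mulmx1.
Qed.

Lemma udiagZ U a (c : R) : c%:C *: udiag U a = udiag U (fun i => c * a i).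
Proof.
have dZ : c%:C *: rdiag a = rdiag (fun i => c * a i).
  by apply/matrixP => i j; rewrite !mxE mulrnAr rmorphM.
by rewrite /udiag -dZ -scalemxAr -scalemxAl.
Qed.

Lemma mxtrace_udiag U a : U \is unitarymx -> \tr (udiag U a) = (\sum_i a i)%:C.
Proof.
move=> /unitarymxP UU; rewrite /udiag mxtrace_mulC mulmxA UU mul1mx.
by rewrite mxtrace_diag rmorph_sum; apply: eq_bigr => i _; rewrite mxE.
Qed.

Lemma udiag_const U (c : R) : U \is unitarymx -> udiag U (fun=> c) = c%:C%:M.
Proof.
move=> Uu; have dc : rdiag (fun=> c) = c%:C%:M.
  by apply/matrixP => i j; rewrite !mxE.
rewrite /udiag dc -mulmxA mul_scalar_mx -scalemxAr.
by rewrite unitary_mulVmx // scalemx1.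
Qed.

Lemma udiag_conj U V a : V *m udiag U a *m V^t* = udiag (U *m V^t*) a.
Proof. by rewrite /udiag adjmx_mul trmxCK !mulmxA. Qed.

Lemma psd_conj A B : psd A -> psd (B *m A *m B^t*).
Proof.
move=> [/hermsymmxP Ah Apos]; split.
  by apply/hermsymmxP; rewrite !adjmx_mul trmxCK -Ah !mulmxA.
by move=> v; have := Apos (B^t* *m v); rewrite adjmx_mul trmxCK !mulmxA.
Qed.

Lemma psd_diag_ge0 A i : psd A -> 0 <= A i i.
Proof.
move=> [_ /(_ (delta_mx i 0))].
by rewrite trmx_delta map_delta_mx -rowE -colE !mxE.
Qed.

Lemma psd_rdiag a : (forall i, 0 <= a i) -> psd (rdiag a).
Proof.
move=> a0; split.
  by apply/hermsymmxP; rewrite adj_rdiag.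
move=> v; rewrite mul_mx_diag mxE; apply: sumr_ge0 => i _.
rewrite !mxE mulrAC mulr_ge0 ?ler0c // mulrC.
exact: mul_conjC_ge0.
Qed.

Lemma psd_udiag U a : (forall i, 0 <= a i) -> psd (udiag U a).
Proof.
by move=> /psd_rdiag a0; have := psd_conj (U^t*) a0; rewrite trmxCK.
Qed.

(** In the eigenbasis [U], the trace is a sum of the [a i] weighted by the diagonal entries of
    [U A U^*], which are nonnegative and add up to [\tr A]. *)
Lemma psd_mxtrace_le A U a (l : R) : psd A -> U \is unitarymx ->
  (forall i, a i <= l) -> \tr (A *m udiag U a) <= l%:C * \tr A.
Proof.
move=> Apsd Uu al.
have trE b : \tr (A *m udiag U b) = \sum_i (U *m A *m U^t*) i i * (b i)%:C.
  rewrite /udiag mulmxA mxtrace_mulC !mulmxA mul_mx_diag.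
  by apply: eq_bigr => i _; rewrite !mxE.
have trA : \tr A = \sum_i (U *m A *m U^t*) i i * 1%:C.
  by rewrite -trE udiag_const // mulmx1.
rewrite trA trE mulr_sumr; apply: ler_sum => i _.
rewrite mulr1 mulrC ler_wpM2r ?lecR //; exact/psd_diag_ge0/psd_conj.
Qed.

(** The spectral theorem; the eigenvalues are diagonal entries of the positive semidefinite
    [U A U^*], hence real and nonnegative, so taking real parts loses nothing. *)
Lemma psd_udiagP A : psd A ->
  exists U a, [/\ U \is unitarymx, forall i, 0 <= a i & A = udiag U a].
Proof.
move=> Apsd; have [Ah _] := Apsd.
have Uu := spectral_unitarymx A; set U := spectralmx A in Uu.
have /orthomx_spectralP AE := hermitian_normalmx Ah.
rewrite -/U (invmx_unitary Uu) in AE.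
have ge0 i : 0 <= spectral_diag A 0 i.
  have := psd_diag_ge0 i (psd_conj U Apsd); rewrite {1}AE !mulmxA.
  rewrite (unitarymxP Uu) mul1mx -mulmxA (unitarymxP Uu) mulmx1.
  by rewrite mxE eqxx mulr1n.
exists U, (fun i => complex.Re (spectral_diag A 0 i)); split; first exact: Uu.
  by move=> i; have := ge0 i; rewrite lecE => /andP[].
rewrite {1}AE /udiag.
suff -> : rdiag (fun i => complex.Re (spectral_diag A 0 i)) =
  diag_mx (spectral_diag A) by [].
rewrite /rdiag; congr diag_mx; apply/rowP => i.
by rewrite mxE RRe_real // ger0_real.
Qed.

(** Entrywise the hypothesis reads T_ij x_j = y_i T_ij: wherever T_ij is nonzero, x_j = y_i and [f]
    takes the same value on both. *)
Lemma diag_intertwine (f : R[i] -> R[i]) T (x y : 'rV_d) :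
  T *m diag_mx x = diag_mx y *m T ->
  T *m diag_mx (map_mx f x) = diag_mx (map_mx f y) *m T.
Proof.
move=> /matrixP TE; apply/matrixP => i j; move: (TE i j).
rewrite !mul_mx_diag !mul_diag_mx 2!mxE => TEij; rewrite !mxE.
have [->|Tij] := eqVneq (T i j) 0; first by rewrite mulr0 mul0r.
by move: TEij; rewrite mulrC => /(mulIf Tij) ->; rewrite mulrC.
Qed.

(* Two diagonalizations of the same matrix are intertwined by T with
   T_ij a_j = b_i T_ij, and T then intertwines f(a) and f(b) for every f: the
   functional calculus does not depend on the diagonalization. *)
Lemma mxpow_udiag U a s : U \is unitarymx ->
  mxpow (udiag U a) s = udiag U (fun i => a i `^ s).
Proof.
move=> Uu; have [UU UV] := (unitarymxP Uu, unitary_mulVmx Uu).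
set A := udiag U a; set W := spectralmx A; set D := spectral_diag A.
have Wu : W \is unitarymx by apply: spectral_unitarymx.
have [WW WV] := (unitarymxP Wu, unitary_mulVmx Wu).
rewrite /mxpow -/W -/D (invmx_unitary Wu).
have nA : A \is normalmx.
  apply/normalmxP; have Ah : A^t* = A.
    by rewrite /A /udiag !adjmx_mul trmxCK mulmxA adj_rdiag.
  by rewrite Ah.
have /orthomx_spectralP := nA; rewrite -/W -/D (invmx_unitary Wu) => AE.
pose T := W *m U^t*.
have TD : T *m rdiag a = diag_mx D *m T.
  have : W *m A *m U^t* = diag_mx D *m T.
    by rewrite {1}AE !mulmxA WW mul1mx.
  by rewrite /A /udiag !mulmxA -(mulmxA _ U) UU mulmx1.
have TfD : T *m rdiag (fun i => a i `^ s) =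
    diag_mx (map_mx (fun z => (complex.Re z `^ s)%:C) D) *m T.
  have := diag_intertwine (fun z => (complex.Re z `^ s)%:C) TD.
  by congr (_ *m diag_mx _ = _); apply/rowP => i; rewrite !mxE.
have WE : W = T *m U by rewrite /T -mulmxA UV mulmx1.
rewrite -mulmxA {2}WE (mulmxA (diag_mx _)) -TfD.
by rewrite /udiag /T !mulmxA WV mul1mx.
Qed.

(** For a left eigenvector v, the coordinates w = v U^* satisfy w_i a_i = z w_i, and some w_i is
    nonzero. Conversely, row i of [U] is an eigenvector for [a i]. *)
Lemma eigenvalue_udiag U a (z : R[i]) : U \is unitarymx ->
  eigenvalue (udiag U a) z <-> exists i, z = (a i)%:C.
Proof.
move=> Uu; have [UU UV] := (unitarymxP Uu, unitary_mulVmx Uu); split.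
  move=> /eigenvalueP[v vA v0].
  have wD : v *m U^t* *m rdiag a = z *: (v *m U^t*).
    by rewrite scalemxAl -vA /udiag -!mulmxA UU mulmx1.
  have /rV0Pn[i wi] : v *m U^t* != 0.
    apply: contra_neq v0 => /(congr1 (mulmx^~ U)).
    by rewrite -mulmxA UV mulmx1 mul0mx.
  exists i; move/rowP: wD => /(_ i); rewrite mul_mx_diag [LHS]mxE [RHS]mxE.
  by rewrite mulrC mxE => /(mulIf wi).
move=> [i ->]; apply/eigenvalueP; exists (row i U).
  rewrite rowE /udiag !mulmxA -(mulmxA _ U) UU mulmx1 scalemxAl.
  congr (_ *m _); apply/rowP => j; rewrite mul_mx_diag !mxE eqxx /=.
  by case: eqP => [->|_]; rewrite ?mul1r ?mulr1 ?mul0r ?mulr0.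
apply/eqP => r0; have := congr1 (mulmx^~ (U^t*)) r0.
rewrite /= -row_mul UU mul0mx row1 => /rowP/(_ i); rewrite !mxE !eqxx.
by move/eqP; rewrite oner_eq0.
Qed.

(** A rank-one matrix has entries C_x B_y. Two nonzero diagonal entries, at i and k, would make C_i
    and B_k nonzero, hence also the off-diagonal entry (i, k). *)
Lemma rank1_udiag U a : U \is unitarymx -> \rank (udiag U a) = 1%N ->
  exists k, forall i, i != k -> a i = 0.
Proof.
move=> Uu rk.
have {rk} : \rank (rdiag a) = 1%N.
  have uu := unitarymx_unit Uu; rewrite -rk /udiag mxrankMfree; last first.
    by rewrite row_free_unit.
  rewrite -[RHS]mxrank_tr trmx_mul mxrankMfree ?mxrank_tr //.
  by rewrite row_free_unit unitmx_tr -(invmx_unitary Uu) unitmx_inv.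
move=> rk; have [k ak] : exists k, a k != 0.
  apply/existsP; apply: contra_eqT rk => /existsPn a0.
  suff -> : rdiag a = 0 by rewrite mxrank0.
  apply/matrixP => i j; rewrite rdiagE mxE.
  by have /negPn/eqP -> := a0 i; rewrite mul0rn.
exists k => i ik; apply/eqP; apply: contraTT ik => ai; apply/negPn/eqP.
have := mulmx_base (rdiag a); move: (col_base _) (row_base _); rewrite rk.
move=> C B /matrixP CB; have CBE x y : C x 0 * B 0 y = rdiag a x y.
  by rewrite -CB mxE big_ord1.
apply/eqP; move: (CBE i i) (CBE k k) (CBE i k).
rewrite !rdiagE !eqxx; have [//|ik] := eqVneq i k.
move=> ii kk /eqP; rewrite mulf_eq0 => /orP[] /eqP z.
  by move/eqP: ii; rewrite z mul0r eq_sym fmorph_eq0 (negPf ai).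
by move/eqP: kk; rewrite z mulr0 eq_sym fmorph_eq0 (negPf ak).
Qed.

End UnitaryDiagonal.

(** * Schur's lemma and averages over the group *)

Section Twirl.
Variables (R : realType) (gT : finGroupType) (d : nat).
Variable rG : mx_representation R[i] [set: gT]%G d.
Hypotheses (rG_irr : mx_irreducible rG) (rG_unitary : unitary_rep rG).
Local Open Scope sesquilinear_scope.

Lemma irr_dim_gt0 : (0 < d)%N.
Proof. by case/mx_irrP: rG_irr. Qed.

(** For an eigenvalue z of [X], the matrix X - z is singular and commutes with the representation;
    by Schur's lemma it would be invertible if it were nonzero. *)
Lemma irr_cent_scalar (X : 'M[R[i]]_d) :
  centgmx rG X -> exists z, X = z%:M.
Proof.
move=> cX; have [z zX] := eigenvalue_closed X irr_dim_gt0.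
exists z; apply/eqP; rewrite -subr_eq0; apply: contraT => nz.
suff /(mx_Schur rG_irr)/(_ nz) : centgmx rG (X - z%:M).
  case/eigenvalueP: zX => v vX v0 Xu; case/eqP: v0.
  by rewrite -(mulmxK Xu v) mulmxBr vX mul_mx_scalar subrr mul0mx.
apply/centgmxP => x Gx; rewrite mulmxBl mulmxBr (centgmxP cX) //.
by rewrite scalar_mxC.
Qed.

Lemma repr_adj g : (rG g)^t* = rG g^-1%g.
Proof. by rewrite -invmx_unitary // repr_mxV ?inE. Qed.

(** Substituting x g for g shows that the sum commutes with every [rG x], so it is scalar; the
    scalar is read off the trace, which conjugation preserves. *)
Lemma twirl_scalar (X : 'M[R[i]]_d) :
  \sum_(g : gT) gu_state rG X g = (#|gT|%:R / d%:R * \tr X)%:M.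
Proof.
set S := \sum_g _.
have [z Sz] : exists z, S = z%:M.
  apply: irr_cent_scalar; apply/centgmxP => x _.
  rewrite /S mulmx_suml mulmx_sumr (reindex_inj (mulgI x)) /=.
  apply: eq_bigr => g _; rewrite /gu_state !repr_adj !repr_mxM ?inE //.
  rewrite invMg repr_mxM ?inE // !mulmxA -(mulmxA _ (rG x^-1%g)).
  have -> : rG x^-1%g *m rG x = 1%:M.
    by rewrite -repr_mxM ?inE // mulVg repr_mx1.
  by rewrite mulmx1.
have trS : \tr S = #|gT|%:R * \tr X.
  rewrite raddf_sum -sum1_card natr_sum mulr_suml; apply: eq_bigr => g _ /=.
  by rewrite mul1r /gu_state mxtrace_mulC mulmxA unitary_mulVmx ?mul1mx //.
have d0 : d%:R != 0 :> R[i] by rewrite pnatr_eq0 -lt0n irr_dim_gt0.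
rewrite Sz; congr _%:M; move: trS; rewrite Sz mxtrace_scalar -[z *+ d]mulr_natr.
by move/(canRL (mulfK d0)) ->; rewrite mulrAC.
Qed.

End Twirl.

(** * Measurements in the orbit of a diagonal operator *)

Section Discrimination.
Variables (R : realType) (gT : finGroupType) (d : nat).
Variable rG : mx_representation R[i] [set: gT]%G d.
Hypotheses (rG_irr : mx_irreducible rG) (rG_unitary : unitary_rep rG).
Local Open Scope sesquilinear_scope.
Variables (U : 'M[R[i]]_d) (Uu : U \is unitarymx).
Implicit Types (a b : 'I_d -> R).

Let n : R := #|gT|%:R.
Let p := fun _ : gT => n^-1.
Let orb b := gu_state rG (udiag U b).

Let n_gt0 : 0 < n.
Proof. by rewrite ltr0n; apply/card_gt0P; exists 1%g. Qed.

Let d_gt0 : 0 < d%:R :> R.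
Proof. by rewrite ltr0n (irr_dim_gt0 rG_irr). Qed.

Let Ug g : U *m (rG g)^t* \is unitarymx.
Proof.
apply: (mul_unitarymx Uu); rewrite trmxC_unitary; exact: rG_unitary.
Qed.

(** The group element only changes the diagonalizing unitary, never the spectrum; for each g, all
    orbits of operators diagonal in [U] thus share an eigenbasis. *)
Lemma gu_udiag b g : orb b g = udiag (U *m (rG g)^t*) b.
Proof. exact: udiag_conj. Qed.

Lemma sum_orbit b : \sum_g orb b g = (n / d%:R * \sum_i b i)%:C%:M.
Proof.
rewrite /orb twirl_scalar // mxtrace_udiag //; congr _%:M.
by rewrite [RHS]rmorphM /= [in RHS]rmorphM /= fmorphV !rmorph_nat.
Qed.

Lemma povm_orbit b : (forall i, 0 <= b i) -> \sum_i b i = d%:R / n ->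
  povm (orb b).
Proof.
move=> b0 sb; split=> [g|]; first by rewrite gu_udiag; exact: psd_udiag.
by rewrite sum_orbit sb mulrA divfK ?gt_eqF // divff ?gt_eqF.
Qed.

(** At each g both operators are diagonal in the same basis, so all n terms are equal and cancel the
    prior 1/n. *)
Lemma succ_prob_orbit a b :
  succ_prob p (orb a) (orb b) = \sum_i b i * a i.
Proof.
rewrite /succ_prob (eq_bigr (fun=> n^-1 * \sum_i b i * a i)) => [|g _].
  by rewrite sumr_const -mulr_natl -/n mulrA divff ?mul1r // gt_eqF.
by rewrite !gu_udiag (udiagM _ _ (Ug g)) (mxtrace_udiag _ (Ug g)).
Qed.

(** Each term is at most l tr N_g / n, and the traces of the N_g add up to tr 1 = d. *)
Lemma succ_prob_le a (l : R) N : (forall i, a i <= l) -> povm N ->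
  succ_prob p (orb a) N <= d%:R / n * l.
Proof.
move=> al [Npsd sN].
have ReD : {morph @complex.Re R : x y / x + y} by case=> ? ? [].
have -> : d%:R / n * l = \sum_g n^-1 * (l * complex.Re (\tr (N g))).
  rewrite -!mulr_sumr -(big_morph _ ReD (erefl : complex.Re 0 = 0)).
  rewrite -raddf_sum sN /= mxtrace1.
  by rewrite -(rmorph_nat (real_complex R)) /= [RHS]mulrA [RHS]mulrC mulrA.
apply: ler_sum => g _; rewrite ler_wpM2l ?invr_ge0 ?(ltW n_gt0) // gu_udiag.
have := psd_mxtrace_le (Npsd g) (Ug g) al; rewrite lecE => /andP[_].
by case: (\tr (N g)) => x y /=; rewrite mul0r subr0.
Qed.

(** The operator to be inverted is a twirl, hence a positive scalar s. The two factors s^(-1/2)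
    combine to 1/s, in which the power of the prior cancels. *)
Lemma power_pgm_orbit a alpha : (forall i, 0 <= a i) ->
  0 < \sum_i a i `^ alpha ->
  power_pgm p (orb a) alpha =
    orb (fun i => d%:R / n / (\sum_i a i `^ alpha) * a i `^ alpha).
Proof.
move=> a0 sa; apply/funext => g; rewrite /power_pgm.
set t := \sum_i _ in sa *.
have E h : mxpow ((p h)%:C *: orb a h) alpha =
    orb (fun i => n^-1 `^ alpha * a i `^ alpha) h.
  rewrite !gu_udiag udiagZ (mxpow_udiag _ _ (Ug h)); congr udiag.
  by apply/funext => i; rewrite powRM // invr_ge0 ltW.
have -> : \sum_h mxpow ((p h)%:C *: orb a h) alpha =
    (n / d%:R * (n^-1 `^ alpha * t))%:C%:M.
  by rewrite (eq_bigr _ (fun h _ => E h)) sum_orbit -mulr_sumr.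
set s := n / d%:R * _.
have s0 : 0 < s by rewrite mulr_gt0 ?divr_gt0 ?mulr_gt0 ?powR_gt0 ?invr_gt0.
(* The scalar is viewed as diagonal in [U] with constant spectrum, so that its power is taken
   entrywise. *)
rewrite -(udiag_const s Uu) (mxpow_udiag _ _ Uu) (udiag_const _ Uu) E !gu_udiag.
rewrite mul_scalar_mx mul_mx_scalar scalerA -rmorphM udiagZ; congr udiag.
apply/funext => i; rewrite -powRD ?(gt_eqF s0) ?implybT //.
have -> : - 2^-1 - 2^-1 = - 1 :> R by lra.
rewrite powR_inv1 ?ltW // mulrA; congr (_ * _).
by rewrite /s; field; rewrite !gt_eqF ?powR_gt0 ?invr_gt0.
Qed.

End Discrimination.

(** * Power-weighted means and their convergence to the maximum *)

Lemma powR_rate (R : realType) (x s : R) : 0 <= x <= 1 -> 0 < s ->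
  (1 - x) * x `^ s <= s^-1.
Proof.
(* The case x = 0 is separate, since the rest of the argument uses ln x. *)
move=> /andP[]; rewrite le_eqVlt => /predU1P[<- _ s0|x0 x1 s0].
  by rewrite powR0 ?gt_eqF // mulr0 invr_ge0 ltW.
rewrite -[X in _ <= X]mul1r ler_pdivlMr // /powR gt_eqF //.
(* Put u = - ln x. Then 1 - x <= u, and s u e^(-su) <= 1 because 1 + su <= e^(su). *)
have lnx : 1 - x <= - ln x.
  by rewrite lerNr opprB -[x in ln x](subrK 1) addrC le_ln1Dx //; lra.
have := expR_ge1Dx (- (s * ln x)); rewrite expRN => h.
have e0 := expR_gt0 (s * ln x).
have h1 : (s * (1 - x)) * expR (s * ln x) <= 1.
  rewrite -ler_pdivlMr // mul1r; apply: le_trans h.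
  rewrite -mulrN; apply: le_trans (_ : s * - ln x <= _); last by rewrite lerDr.
  by rewrite ler_pM2l.
by rewrite mulrAC [_ * s]mulrC.
Qed.

Section PowerMean.
Variables (R : realType) (I : finType) (a : I -> R).

Definition powR_mean s := (\sum_i a i `^ s * a i) / \sum_i a i `^ s.

Variable k : I.
Hypotheses (a0 : forall i, 0 <= a i) (ak : forall i, a i <= a k).
Hypothesis ak0 : 0 < a k.

Lemma sum_powR_gt0 s : 0 < \sum_i a i `^ s.
Proof.
rewrite (bigD1 k) //= ltr_wpDr ?powR_gt0 //.
by apply: sumr_ge0 => i _; exact: powR_ge0.
Qed.

(** All terms of this sum are nonnegative, so the bound, its strictness and the rate of convergence
    can each be read off it. *)
Lemma powR_mean_gap s :
  a k - powR_mean s = (\sum_i (a k - a i) * a i `^ s) / \sum_i a i `^ s.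
Proof.
have s0 := sum_powR_gt0 s.
rewrite /powR_mean; apply: (canLR (addrK _)); rewrite -mulrDl -big_split /=.
rewrite (eq_bigr (fun i => a k * a i `^ s)) => [|i _]; last by ring.
by rewrite -mulr_sumr mulfK // gt_eqF.
Qed.

Lemma powR_mean_le s : powR_mean s <= a k.
Proof.
rewrite -subr_ge0 powR_mean_gap divr_ge0 ?(ltW (sum_powR_gt0 _)) //.
by apply: sumr_ge0 => i _; rewrite mulr_ge0 ?powR_ge0 // subr_ge0.
Qed.

(** The term of index i in the gap is positive: neither its weight nor its distance to the maximum
    vanishes. *)
Lemma powR_mean_lt s i : 0 < a i < a k -> powR_mean s < a k.
Proof.
move=> /andP[ai0 aik]; rewrite -subr_gt0 powR_mean_gap.
rewrite divr_gt0 ?sum_powR_gt0 // (bigD1 i) //=.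
rewrite ltr_wpDr ?mulr_gt0 ?powR_gt0 ?subr_gt0 //.
by apply: sumr_ge0 => j _; rewrite mulr_ge0 ?powR_ge0 // subr_ge0.
Qed.

(** The denominator is at least (a_k)^s. With r = a_i / a_k, each term of the numerator is a_k
    (a_k)^s (1 - r) r^s, and [powR_rate] bounds (1 - r) r^s by 1/s. *)
Lemma powR_mean_gap_le s : 0 < s -> a k - powR_mean s <= #|I|%:R * a k / s.
Proof.
move=> s0; rewrite powR_mean_gap ler_pdivrMr ?sum_powR_gt0 //.
have aks : 0 < a k `^ s by rewrite powR_gt0.
apply: (@le_trans _ _ (#|I|%:R * a k / s * a k `^ s)); last first.
  have C0 : 0 <= #|I|%:R * a k / s by rewrite divr_ge0 ?mulr_ge0 ?(ltW s0).
  rewrite ler_wpM2l // (bigD1 k) //= lerDl.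
  by apply: sumr_ge0 => i _; exact: powR_ge0.
rewrite -!mulrA mulr_natl -sumr_const; apply: ler_sum => i _.
have r01 : 0 <= a i / a k <= 1.
  by rewrite divr_ge0 ?(ltW ak0) //= ler_pdivrMr ?mul1r.
have -> : a i = a k * (a i / a k) by rewrite mulrCA divff ?mulr1 // gt_eqF.
set r := a i / a k in r01 *; have /andP[r0 _] := r01.
rewrite powRM ?(ltW ak0) // -[X in X - _]mulr1 -mulrBr -mulrA ler_pM2l //.
by rewrite mulrCA mulrC ler_pM2r // powR_rate.
Qed.

Lemma powR_mean_cvg : powR_mean s @[s --> +oo] --> a k.
Proof.
apply/cvgrPdist_le => e e0; near=> s.
have s0 : 0 < s by near: s; exact: nbhs_pinfty_gt.
rewrite ger0_norm ?subr_ge0 ?powR_mean_le //.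
apply: le_trans (powR_mean_gap_le s0) _.
by rewrite ler_pdivrMr // -ler_pdivrMl.
Unshelve. all: by end_near. Qed.

End PowerMean.

(** * Attained suprema and the final assembly *)

Lemma sup_maximum (R : realType) (S : set R) (x : R) :
  S x -> ubound S x -> sup S = x.
Proof.
move=> Sx Sub; apply/eqP; rewrite eq_le ge_sup //; last by exists x.
by apply: sup_upper_bound => //; split; exists x.
Qed.

Theorem mainTheorem5 (R : realType) (gT : finGroupType) (d : nat)
    (rG : mx_representation R[i] [set: gT]%G d)
    (rG_irr : mx_irreducible rG) (rG_unitary : unitary_rep rG)
    (rho : 'M[R[i]]_d) (rho_state : quantum_state rho) :
  let n := #|gT| in
  let p := fun _ : gT => n%:R^-1 : R in
  let rhos := gu_state rG rho in
  let psucc := fun alpha : R => succ_prob p rhos (power_pgm p rhos alpha) in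
  let pstar := opt_succ_prob p rhos in
  [/\ (exists M, optimal p rhos M) /\
        pstar = d%:R / n%:R * lambda_max rho,
      forall alpha : R, 1 <= alpha ->
        (psucc alpha)%:C =
          d%:R / n%:R * (\tr (mxpow rho (alpha + 1)) / \tr (mxpow rho alpha)),
      pure_state rho ->
        (forall alpha : R, 1 <= alpha ->
          \tr (mxpow rho (alpha + 1)) = \tr (mxpow rho alpha)) /\
        optimal p rhos (power_pgm p rhos 1)
    & mixed_state rho ->
        psucc alpha @[alpha --> +oo] --> pstar /\
        (~ flat_spectrum rho ->
          forall alpha : R, 1 <= alpha ->
            psucc alpha < pstar /\
            ~ optimal p rhos (power_pgm p rhos alpha))].
Proof.
move=> n p rhos psucc pstar.
have [rho_psd trho] := rho_state.
have [U [a [Uu a0 rhoE]]] := psd_udiagP rho_psd.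
have trE s : \tr (mxpow rho s) = (\sum_i a i `^ s)%:C.
  by rewrite rhoE mxpow_udiag // mxtrace_udiag.
have eigE z : eigenvalue rho z <-> exists i, z = (a i)%:C.
  by rewrite rhoE; exact: eigenvalue_udiag.
have sum_a : \sum_i a i = 1.
  by apply: complexI; rewrite -(mxtrace_udiag _ Uu) -rhoE trho.
have d_gt0 : 0 < d%:R :> R by rewrite ltr0n (irr_dim_gt0 rG_irr).
have n_gt0 : 0 < n%:R :> R by rewrite ltr0n; apply/card_gt0P; exists 1%g.
have dn_gt0 : 0 < d%:R / n%:R :> R by rewrite divr_gt0.
have [k ak] : exists k, forall i, a i <= a k.
  have i0 := Ordinal (irr_dim_gt0 rG_irr).
  have [k _ ak] := @Order.TotalTheory.arg_maxP _ _ _ i0 predT a isT.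
  by exists k => i; exact: ak.
have ak_gt0 : 0 < a k.
  rewrite lt0r a0 andbT; apply/eqP => ak0.
  have : (0 : R) < \sum_i a i by rewrite sum_a.
  rewrite ltNge => /negP; apply.
  by apply: sumr_le0 => i _; rewrite -ak0.
have lE : lambda_max rho = a k.
  apply: sup_maximum; first by apply/eigE; exists k.
  by move=> x /eigE[i /complexI ->].
have le_top N : povm N -> succ_prob p rhos N <= d%:R / n%:R * a k.
  by move=> Npovm; rewrite /rhos rhoE; exact: succ_prob_le.
have opt_top M : povm M -> succ_prob p rhos M = d%:R / n%:R * a k ->
    optimal p rhos M.
  by move=> Mpovm ME; split=> // N /le_top; rewrite ME.
have [M Mpovm ME] : exists2 M, povm M & succ_prob p rhos M = d%:R / n%:R * a k.
  (* All the weight d/n allowed by [povm_orbit] goes to one eigenvector of the largest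
     eigenvalue. *)
  pose b i := d%:R / n%:R * (i == k)%:R : R.
  exists (gu_state rG (udiag U b)).
    apply: povm_orbit => // [i|]; first by rewrite mulr_ge0 ?(ltW dn_gt0).
    rewrite -mulr_sumr (bigD1 k) //= eqxx big1 ?addr0 ?mulr1 //.
    by move=> i /negPf ->.
  rewrite /rhos rhoE succ_prob_orbit // (bigD1 k) //= /b eqxx mulr1.
  by rewrite big1 ?addr0 // => i /negPf ->; rewrite mulr0 mul0r.
have pstarE : pstar = d%:R / n%:R * a k.
  by apply: sup_maximum => [|x [N /le_top ? ->//]]; exists M.
have pgmE s : power_pgm p rhos s = gu_state rG (udiag U
    (fun i => d%:R / n%:R / (\sum_i a i `^ s) * a i `^ s)).
  by rewrite /rhos rhoE power_pgm_orbit // (sum_powR_gt0 ak_gt0).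
have pgm_povm s : povm (power_pgm p rhos s).
  have s0 := sum_powR_gt0 ak_gt0 s.
  rewrite pgmE; apply: povm_orbit => // [i|].
    by rewrite mulr_ge0 ?powR_ge0 ?divr_ge0 ?ltW.
  by rewrite -mulr_sumr divfK ?gt_eqF.
have psuccE s : psucc s = d%:R / n%:R * powR_mean a s.
  rewrite /psucc pgmE /rhos rhoE succ_prob_orbit // /powR_mean.
  transitivity (d%:R / n%:R / (\sum_i a i `^ s) * \sum_i a i `^ s * a i).
    by rewrite mulr_sumr; apply: eq_bigr => i _; rewrite mulrA.
  by rewrite mulrAC -mulrA.
split.
- by split; [exists M; exact: opt_top | rewrite pstarE lE].
- move=> s s1; rewrite psuccE [X in _ = _ * (X / _)]trE.
  rewrite [X in _ = _ * (_ / X)]trE /powR_mean.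
  (* The exponents add even at zero eigenvalues, because s + 1 is nonzero. *)
  have -> : \sum_i a i `^ (s + 1) = \sum_i a i `^ s * a i.
    apply: eq_bigr => i _; rewrite powRD ?powRr1 //.
    by rewrite gt_eqF // addr_gt0 // (lt_le_trans ltr01).
  by rewrite !rmorphM !fmorphV /= !rmorph_nat.
- case=> _; rewrite rhoE => /(rank1_udiag Uu)[l al].
  (* The only possibly nonzero eigenvalue sits at the maximum, and unit trace makes it 1. *)
  have kl : k = l.
    by apply/eqP; apply: contraTT ak_gt0 => /al ->; rewrite ltxx.
  rewrite -{l}kl in al.
  have ak1 : a k = 1 by rewrite -sum_a (bigD1 k) //= big1 ?addr0.
  have sum_pow s : s != 0 -> \sum_i a i `^ s = 1.
    move=> s0; rewrite (bigD1 k) //= ak1 powR1 big1 ?addr0 // => i /al ->.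
    by rewrite powR0.
  rewrite -rhoE; split=> [s s1|].
    have s0 : 0 < s := lt_le_trans ltr01 s1.
    by rewrite [LHS]trE [RHS]trE !sum_pow // gt_eqF // addr_gt0.
  apply: opt_top => //; rewrite -/(psucc 1) psuccE /powR_mean.
  rewrite sum_pow ?oner_eq0 // (bigD1 k) //=.
  rewrite big1 => [|i /al ->]; last by rewrite mulr0.
  by rewrite ak1 powRr1 ?ler01 // !(mulr1, addr0, divr1).
- move=> _; split.
    rewrite pstarE (_ : psucc = fun s => d%:R / n%:R * powR_mean a s);
      last exact/funext.
    by apply: cvgMr; exact: powR_mean_cvg.
  move=> nflat s s1.
  (* Otherwise every nonzero eigenvalue equals [a k] and the spectrum is flat. On a flat spectrum
     the mean is exactly [a k] for every s >= 1, so strictness fails there. *)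
  have [i aik] : exists i, 0 < a i < a k.
    apply: contra_notP nflat => /forallNP nex.
    have top i : a i != 0 -> a i = a k.
      move=> ai; have := nex i; rewrite lt0r ai a0 /= lt_neqAle ak andbT.
      by move=> /negP/negPn/eqP.
    move=> _ _ /eigE[i ->] /eigE[j ->]; rewrite !fmorph_eq0.
    by move=> /top -> /top ->.
  have lt_s : psucc s < pstar.
    by rewrite psuccE pstarE ltr_pM2l //; exact: powR_mean_lt aik.
  (* Optimality would force a value at least that of [M], which attains [pstar]. *)
  by split=> // -[_ /(_ M Mpovm)]; rewrite ME -pstarE leNgt lt_s.
Qed.
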